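(* There is a (topologically) strongly mixing dynamical system which is a van der Waerden system but does not have the multiple IP-recurrence property.
   Context: A (topological) dynamical system $(X,T)$ consists of a (nonempty) compact metric space and a continuous map $T\colon X\to X$. $\mathbb{N}$ is the set of positive integers. $(X,T)$ is strongly mixing if for every two non-empty open $U,V\subset X$ the set $\{n\in\mathbb{N}:T^nU\cap V\ne\emptyset\}$ is cofinite in $\mathbb{N}$. $(X,T)$ is a van der Waerden system if for every non-empty open $U\subset X$ and every $d\in\mathbb{N}$ there exists $n\in\mathbb{N}$ such that $U\cap T^{-n}U\cap T^{-2n}U\cap\dots\cap T^{-dn}U\ne\emptyset$. $(X,T)$ has the multiple IP-recurrence property if for every non-empty open $U\subset X$, every $d\ge1$ and all sequences $\{p_i^{(1)}\}_{i=1}^\infty,\dots,\{p_i^{(d)}\}_{i=1}^\infty$ in $\mathbb{N}$ (generating the IP-sets $FS\{p_i^{(j)}\}_{i=1}^\infty$ of all sums $\sum_{i\in\alpha}p_i^{(j)}$ over non-empty finite $\alpha\subset\mathbb{N}$), there exists a non-empty finite subset $\alpha$ of $\mathbb{N}$ such that \[U\cap T^{-\sum_{i\in\alpha}p_i^{(1)}}U\cap T^{-\sum_{i\in\alpha}p_i^{(2)}}U\cap\dots\cap T^{-\sum_{i\in\alpha}p_i^{(d)}}U\ne\emptyset.\] *)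

(* Defs.v *)
From mathcomp Require Import all_boot all_order all_algebra finmap.
From mathcomp Require Import all_classical all_reals all_analysis.

Set Implicit Arguments.
Unset Strict Implicit.
Unset Printing Implicit Defensive.

Local Open Scope classical_set_scope.

Definition dynamical_system (R : realType) (X : metricType R) (T : X -> X) : Prop :=
  [/\ [set: X] !=set0, compact [set: X] & continuous T].

(* The paper's N is the set of positive integers, whence the explicit
   positivity conditions on naturals below. *)

Definition strongly_mixing (X : topologicalType) (T : X -> X) : Prop :=
  forall U V : set X, open U -> open V -> U !=set0 -> V !=set0 ->
    finite_set ([set n : nat | (0 < n)%N] `\`
                [set n : nat | (iter n T @` U) `&` V !=set0]).

Definition van_der_Waerden_system (X : topologicalType) (T : X -> X) : Prop :=
  forall U : set X, open U -> U !=set0 ->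
  forall d : nat, (0 < d)%N ->
    exists2 n : nat, (0 < n)%N &
      U `&` \bigcap_(j in [set j : nat | (1 <= j <= d)%N])
              (iter (j * n)%N T @^-1` U) !=set0.

(* The j-th sequence is [p j]; its terms are indexed from 0 instead of 1, and
   correspondingly [alpha] is a finite set of natural numbers including 0. *)
Definition multiple_IP_recurrence (X : topologicalType) (T : X -> X) : Prop :=
  forall U : set X, open U -> U !=set0 ->
  forall d : nat, (0 < d)%N ->
  forall p : 'I_d -> nat -> nat, (forall j i, (0 < p j i)%N) ->
    exists2 alpha : {fset nat}, alpha != fset0 &
      U `&` \bigcap_(j in [set: 'I_d])
              (iter (\sum_(i <- alpha) p j i)%N T @^-1` U) !=set0.

(* Main.v *)
Require Import Defs.
From HB Require Import structures.
From mathcomp Require Import all_boot all_order all_algebra finmap.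
From mathcomp Require Import zify.
From mathcomp Require Import all_classical all_reals all_analysis.

(** The example is the one-sided shift on the space of 0-1 sequences [x] that
    never take the value 1 at [t], [t + a] and [t + b] simultaneously, where
    [(a, b)] runs over the pairs
        a = sum of 2 ^ i over alpha,   b = sum of 4 ^ i over alpha
    with [alpha] a non-empty finite set of naturals. This is a closed
    shift-invariant condition, so it defines a compact system, and the
    cylinder of the sequences with [x 0 = 1] is by construction never
    recurrent along the two IP-sets generated by [2 ^ i] and [4 ^ i].

    Everything else follows from one property of the pairs [(a, b)], called
    [lacunary] below: for every [K], all pairs outside a bounded set have both
    [a > K] and [b > K * a]. Take admissible sequences, cut them to a fixed
    length [L], and write them at the positions 0, n, 2n, .., dn, with zeros in
    between. If a forbidden triple [t, t + a, t + b] appears in the result and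
    [n] is large, then either [a] and [b] are small, so that the triple lies
    within one block and contradicts the admissibility of that block, or [a]
    exceeds the length of a block; in the latter case the triple changes
    block from [t] to [t + a], so that [a >= n - L], while
    [b <= (d + 1) * n], which bounds [b / a] and contradicts lacunarity
    (lemma [blocks_avoid]). Hence all such concatenations are admissible for
    every large [n]: two different blocks give strong mixing, and [d + 1]
    copies of the same block give the van der Waerden property. *)

Set Implicit Arguments.
Unset Strict Implicit.
Unset Printing Implicit Defensive.

Import Order.TTheory GRing.Theory Num.Theory.

Local Open Scope classical_set_scope.

(** * The metric space of sequences avoiding a family of triples *)

Definition avoids (D : nat -> nat -> Prop) (x : nat -> bool) :=
  forall t a b, D a b -> ~~ [&& x t, x (t + a)%N & x (t + b)%N].

(** The parameter [R] lets the type carry a canonical [R]-valued metric. *)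
Record avoiding_shift (R : realType) (D : nat -> nat -> Prop) := AvoidingSeq {
  seq_of :> nat -> bool;
  seq_of_avoids : avoids D seq_of }.

Section metric.
Variables (R : realType) (D : nat -> nat -> Prop).
Local Notation X := (avoiding_shift R D).
Implicit Types (x y z : X).

HB.instance Definition _ := gen_eqMixin X.
HB.instance Definition _ := gen_choiceMixin X.

Lemma seq_of_inj x y : seq_of x =1 seq_of y -> x = y.
Proof.
case: x y => [x hx] [y hy] /= /funext exy; rewrite exy in hx *.
by congr AvoidingSeq; apply: Prop_irrelevance.
Qed.

(** The usual ultrametric of a sequence space: the inverse of the first
    (one-based) position at which the sequences differ. *)
Definition seq_dist x y : R :=
  if pselect (exists i, x i != y i) is left h then (ex_minn h).+1%:R^-1%R
  else 0%R.

Lemma seq_dist_lt x y n :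
  (seq_dist x y < n.+1%:R^-1)%R <-> forall i, (i <= n)%N -> x i = y i.
Proof.
rewrite /seq_dist; case: pselect => [h|h]; last first.
  rewrite invr_gt0 ltr0n; split=> // _ i _.
  by apply/eqP/negPn/negP => xy; apply: h; exists i.
rewrite ltf_pV2 ?posrE ?ltr0n// ltr_nat ltnS.
case: ex_minnP => m xym minm; split=> [nm i im|agree].
  by apply/eqP/negPn/negP => /minm; rewrite leqNgt (leq_ltn_trans im nm).
by rewrite ltnNge; apply/negP => /agree/eqP; rewrite (negPf xym).
Qed.

Lemma seq_dist_ge x y i : x i != y i -> (i.+1%:R^-1 <= seq_dist x y)%R.
Proof.
move=> xyi; rewrite leNgt; apply/negP => /seq_dist_lt /(_ i (leqnn i))/eqP.
exact/negP.
Qed.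

Lemma seq_dist_ge0 x y : (0 <= seq_dist x y)%R.
Proof. by rewrite /seq_dist; case: pselect => // h; rewrite invr_ge0 ler0n. Qed.

Lemma seq_distxx x : seq_dist x x = 0%R.
Proof.
rewrite /seq_dist; case: pselect => // h.
by exfalso; case: h => i; rewrite eqxx.
Qed.

Lemma seq_dist_eq0 x y : seq_dist x y = 0%R -> x = y.
Proof.
move=> xy0; apply: seq_of_inj => i; apply/eqP/negPn/negP => /seq_dist_ge.
by rewrite xy0 leNgt invr_gt0 ltr0n.
Qed.

Lemma seq_distC x y : seq_dist x y = seq_dist y x.
Proof.
wlog suff: x y / (seq_dist x y <= seq_dist y x)%R.
  by move=> H; apply/eqP; rewrite eq_le !H.
rewrite {1}/seq_dist; case: pselect => [h|_]; last exact: seq_dist_ge0.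
case: ex_minnP => m xym _.
by apply: seq_dist_ge; rewrite eq_sym.
Qed.

Lemma seq_dist_triangle y x z :
  (seq_dist x z <= seq_dist x y + seq_dist y z)%R.
Proof.
rewrite {1}/seq_dist; case: pselect => [h|_]; last first.
  by rewrite addr_ge0 ?seq_dist_ge0.
case: ex_minnP => m xzm _.
have [xym|/seq_dist_ge xym] := eqVneq (x m) (y m).
  rewrite xym in xzm.
  by rewrite (le_trans (seq_dist_ge xzm))// lerDr seq_dist_ge0.
by rewrite (le_trans xym)// lerDl seq_dist_ge0.
Qed.

HB.instance Definition _ :=
  isMetric.Build R X seq_distxx seq_dist_eq0 seq_distC seq_dist_triangle.

(** All topological questions below are reduced by this lemma to statements
    about finite prefixes. *)
Lemma nbhs_cylinderP x (A : set X) :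
  nbhs x A <->
  exists n, forall y, (forall i, (i < n)%N -> y i = x i) -> A y.
Proof.
split.
  move=> /nbhs_ballP[e /= e0 eA].
  have [n ne] : exists n, (n.+1%:R^-1 < e)%R.
    exists (Num.bound e^-1); rewrite invf_plt ?posrE ?ltr0n//.
    rewrite (lt_le_trans (archi_boundP _)) ?invr_ge0 ?(ltW e0)//.
    by rewrite ler_nat.
  exists n.+1 => y xy; apply: eA; rewrite ballEmdist /=.
  by apply: lt_trans ne; apply/seq_dist_lt => i ni; rewrite xy.
move=> [n An]; apply/nbhs_ballP; exists n.+1%:R^-1%R => /=.
  by rewrite invr_gt0 ltr0n.
move=> y; rewrite ballEmdist /= => /seq_dist_lt xy.
by apply: An => i /ltnW /xy.
Qed.

(** An ultrafilter decides the value of each coordinate; the sequence [l] of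
    these values is its limit. Since any prefix of [l] is a prefix of some
    sequence of the space, and avoidance only tests finitely many coordinates
    at a time, [l] again avoids the triples. *)
Lemma avoiding_shift_compact : compact [set: X].
Proof.
rewrite compact_ultra => F FU _.
pose l i := `[< F [set y : X | y i] >].
have Fl i : F [set y : X | y i = l i].
  rewrite /l; case: (in_ultra_setVsetC [set y : X | y i] FU) => Fi.
    by rewrite (asboolT Fi); apply: filterS Fi => y /= ->.
  rewrite asboolF; first by apply: filterS Fi => y /= /negP/negbTE.
  move=> Fi'; have : F set0.
    by apply: filterS (filterI Fi Fi') => y [].
  exact: filter_not_empty.
have Fln n : F [set y : X | forall i, (i < n)%N -> y i = l i].
  elim: n => [|n IH]; first by apply: filterS filterT.
  apply: filterS (filterI IH (Fl n)) => y [/= yl yn] i.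
  by rewrite ltnS leq_eqVlt => /predU1P[->//|/yl].
have lD : avoids D l.
  move=> t a b Dab; have [y /= yl] := filter_ex (Fln (t + a + b).+1).
  have := seq_of_avoids y t Dab.
  by rewrite !yl ?ltnS -?addnA ?leq_addr ?leq_add2l ?leq_addl ?leq_addr.
exists (AvoidingSeq R lD); split=> // A /nbhs_cylinderP[n An].
by apply: filterS (Fln n) => y /= yl; apply: An => i /yl.
Qed.

(** * The shift map *)

Lemma shift_avoids x : avoids D (fun i => x i.+1).
Proof. by move=> t a b; rewrite -!addSn; apply: seq_of_avoids. Qed.

Definition shift x : X := AvoidingSeq R (@shift_avoids x).

Lemma iter_shift n x i : iter n shift x i = x (n + i)%N.
Proof. by elim: n i => [//|n IH] i /=; rewrite IH addnS. Qed.

Lemma shift_continuous : continuous shift.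
Proof.
move=> x A /nbhs_cylinderP[n An]; apply/nbhs_cylinderP; exists n.+1 => y xy.
by apply: An => i ni /=; rewrite xy.
Qed.

Lemma open_cylinder (U : set X) x : open U -> U x ->
  exists n, forall y, (forall i, (i < n)%N -> y i = x i) -> U y.
Proof. by move=> oU Ux; apply/nbhs_cylinderP/open_nbhs_nbhs. Qed.

End metric.

(** * Concatenation of distant blocks *)

(** When [L <= n], the [j]-th block, for [j <= d], is the prefix of length [L] of [u j],
    written from position [j * n] on; all other values are 0. *)
Definition blocks (d L n : nat) (u : nat -> nat -> bool) (i : nat) :=
  [&& i %/ n <= d, i %% n < L & u (i %/ n) (i %% n)]%N.

Lemma blocksE d L n u j i : (j <= d)%N -> (i < L)%N -> (L <= n)%N ->
  blocks d L n u (j * n + i) = u j i.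
Proof.
move=> jd iL Ln; have n0 : (i < n)%N by apply: leq_trans Ln.
rewrite /blocks divnMDl ?(leq_ltn_trans _ n0)// divn_small// addn0.
by rewrite modnMDl modn_small// jd iL.
Qed.

(** The pairs tend to infinity in such a way that not only [a] and [b] but
    also the ratio [b / a] become arbitrarily large. *)
Definition lacunary (D : nat -> nat -> Prop) :=
  forall K, exists M, forall a b, D a b ->
    (a <= M)%N /\ (b <= M)%N \/ (K < a)%N /\ (K * a < b)%N.

(** The key point: at distance [n] large, no forbidden triple can meet two
    different blocks. A triple with [a, b <= M] cannot cross a gap, hence stays
    in its block. Otherwise [a > L] forces [t] and [t + a] into different
    blocks, so that [n < 2 * a], and then [b > 2 * d.+1 * a >= d.+1 * n] is larger than
    the whole concatenation. *)
Lemma blocks_avoid D d L : lacunary D ->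
  exists2 N, (L <= N)%N &
    forall n u, (N <= n)%N -> (forall j, avoids D (u j)) ->
    avoids D (blocks d L n u).
Proof.
(* [2 * d.+1] bounds the ratio [b / a] of a triple that meets several blocks,
   and the summand [L] makes [a] exceed the length of a block. *)
move=> /(_ (2 * d.+1 + L)%N)[M DM]; exists (2 * L + M).+1; first by lia.
move=> n u Nn uD t a b Dab; apply/and3P.
rewrite /blocks => -[/and3P[q0 r0 ut] /and3P[q1 r1 uta] /and3P[q2 r2 utb]].
have n0 : (0 < n)%N by lia.
case: (DM _ _ Dab) => [[aM bM]|[Ka Kb]].
  have small c : (c <= M)%N ->
      (t + c) %/ n = t %/ n /\ (t + c) %% n = (t %% n + c)%N.
    move=> cM; have rc : (t %% n + c < n)%N by lia.
    have -> : (t + c = t %/ n * n + (t %% n + c))%N.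
      by rewrite addnA -divn_eq.
    by rewrite divnMDl// (divn_small rc) addn0 modnMDl modn_small.
  have [qa ra] := small _ aM; have [qb rb] := small _ bM.
  rewrite qa ra in uta; rewrite qb rb in utb.
  by have := uD (t %/ n) (t %% n) _ _ Dab; rewrite ut uta utb.
have eqt := divn_eq t n; have eqta := divn_eq (t + a) n.
have eqtb := divn_eq (t + b) n.
have leM q q' : (q <= q')%N -> (q * n <= q' * n)%N.
  by rewrite leq_mul2r orbC => ->.
have aL : (L < a)%N by lia.
have qlt : (t %/ n < (t + a) %/ n)%N.
  by rewrite ltnNge; apply/negP => /leM; lia.
have an : (n <= a + L)%N by move/leM: qlt; rewrite mulSn; lia.
have bn : (b <= d.+1 * n)%N by move/leM: q2; rewrite mulSn; lia.
have : (d.+1 * n <= d.+1 * (2 * a))%N by rewrite leq_mul2l; lia.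
rewrite mulnDl in Kb; rewrite mulnA [(_ * 2)%N]mulnC; lia.
Qed.

(** * Strong mixing and the van der Waerden property *)

Section dynamics.
Variables (R : realType) (D : nat -> nat -> Prop).
Hypothesis lacD : lacunary D.
Local Notation X := (avoiding_shift R D).

Lemma shift_strongly_mixing : strongly_mixing (@shift R D).
Proof.
move=> U V oU oV [x Ux] [y Vy].
have [k Uk] := open_cylinder oU Ux; have [l Vl] := open_cylinder oV Vy.
have [N LN zD] := blocks_avoid 1 (maxn k l) lacD.
apply: (@sub_finite_set _ _ `I_N); last exact: finite_II.
move=> n /= [_ nUV]; rewrite ltnNge; apply/negP => Nn; apply: nUV.
(* A word of [U] followed, [n] steps later, by a word of [V]. *)
have uD j : avoids D (if j is 0 then seq_of x else seq_of y).
  by case: j => [|j]; apply: seq_of_avoids.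
pose z : X := AvoidingSeq R (zD n _ Nn uD); have Ln := leq_trans LN Nn.
exists (iter n (@shift R D) z); split.
  exists z => //; apply: Uk => i ik.
  by rewrite /= -[i in LHS](add0n i) -(mul0n n) blocksE// leq_max ik.
apply: Vl => i il; rewrite iter_shift /= -[X in (X + i)%N]mul1n.
by rewrite blocksE// leq_max il orbT.
Qed.

Lemma shift_van_der_Waerden : van_der_Waerden_system (@shift R D).
Proof.
move=> U oU [x Ux] d _; have [k Uk] := open_cylinder oU Ux.
have [N LN zD] := blocks_avoid d k lacD; have Ln := leqW LN.
have z_avoids := zD N.+1 _ (leqnSn N) (fun=> seq_of_avoids x).
pose z : X := AvoidingSeq R z_avoids.
have Uz j : (j <= d)%N -> U (iter (j * N.+1) (@shift R D) z).
  by move=> jd; apply: Uk => i ik; rewrite iter_shift /= blocksE.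
exists N.+1 => //; exists z; split; first exact: (Uz 0).
by move=> j /= /andP[_ jd]; apply: Uz.
Qed.

End dynamics.

(** * A lacunary family generated by two IP-sets *)

Definition power_sum (j : nat) (alpha : {fset nat}) :=
  (\sum_(i <- alpha) 2 ^ (j.+1 * i))%N.

Lemma power_sum_ge j (alpha : {fset nat}) m :
  m \in alpha -> (2 ^ (j.+1 * m) <= power_sum j alpha)%N.
Proof. by move=> am; rewrite /power_sum (big_fsetD1 m)//= leq_addr. Qed.

Lemma sum_expn_lt q m : (1 < q)%N -> (\sum_(0 <= i < m) q ^ i < q ^ m)%N.
Proof.
move=> q1; elim: m => [|m IH]; first by rewrite big_geq.
rewrite big_nat_recr//= expnS; nia.
Qed.

Lemma power_sum_lt j (alpha : {fset nat}) m :
  (forall i, i \in alpha -> i <= m)%N ->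
  (power_sum j alpha < 2 ^ (j.+1 * m.+1))%N.
Proof.
move=> am; rewrite expnM; apply: leq_ltn_trans (sum_expn_lt _ _); last first.
  by rewrite -{1}(expn0 2) ltn_exp2l.
rewrite /power_sum; under eq_bigr do rewrite expnM.
apply: uniq_sub_le_big => //; first by move=> ? ?; apply: leq_addr.
  exact: iota_uniq.
by move=> i /am im; rewrite mem_index_iota.
Qed.

Lemma fset_has_max (alpha : {fset nat}) : alpha != fset0 ->
  exists2 m, m \in alpha & forall i, i \in alpha -> (i <= m)%N.
Proof.
move=> /fset0Pn exA.
have bA i : i \in alpha -> (i <= \max_(j <- alpha) j)%N.
  by move=> iA; apply: leq_bigmax_seq.
by case: (ex_maxnP exA bA) => m mA mmax; exists m.
Qed.

Definition power_pairs (a b : nat) :=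
  exists2 alpha : {fset nat}, alpha != fset0 &
    a = power_sum 0 alpha /\ b = power_sum 1 alpha.

(** Let [m] be the maximum of [alpha]. Then [2 ^ m <= a < 2 * 2 ^ m], whereas
    [b >= 4 ^ m = 2 ^ m * 2 ^ m]; hence [b / a] exceeds [2 ^ m / 2]. For
    [m <= 2 * K] both sums are bounded; for larger [m], [2 ^ m > 2 * K]. *)
Lemma lacunary_power_pairs : lacunary power_pairs.
Proof.
move=> K; exists (2 ^ (2 * (2 * K).+1))%N.
move=> _ _ [alpha /fset_has_max[m am mmax] [-> ->]].
have a_lt := power_sum_lt 0 mmax; have b_lt := power_sum_lt 1 mmax.
have a_ge := power_sum_ge 0 am; have b_ge := power_sum_ge 1 am.
have [mK|Km] := leqP m (2 * K).
  left; split; apply: ltnW; [apply: leq_trans a_lt _|apply: leq_trans b_lt _];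
  by rewrite leq_exp2l//; lia.
right; have := ltn_expl m (leqnn 2).
rewrite !mul1n expnS in a_lt a_ge; rewrite mulnC expnM in b_ge.
by split; nia.
Qed.

(** * Failure of multiple IP-recurrence *)

Section counterexample.
Variable R : realType.
Local Notation X := (avoiding_shift R power_pairs).

Lemma singleton_avoids : avoids power_pairs (fun i => i == 0%N).
Proof.
move=> t a b [alpha /fset_has_max[m am _] [-> _]]; apply/and3P => -[_ ta0 _].
move: ta0; rewrite addn_eq0 => /andP[_]; apply/negP; rewrite -lt0n.
by apply: leq_trans (power_sum_ge 0 am); rewrite expn_gt0.
Qed.

Lemma shift_not_multiple_IP_recurrence :
  ~ multiple_IP_recurrence (@shift R power_pairs).
Proof.
pose U : set X := [set x : X | x 0%N].
have oU : open U.
  rewrite openE => x Ux; apply/nbhs_cylinderP; exists 1%N => y xy.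
  by rewrite /U /= xy.
have U0 : U !=set0 by exists (AvoidingSeq R singleton_avoids).
move=> /(_ U oU U0 2%N isT (fun j i => 2 ^ (j.+1 * i))%N)[|alpha a0].
  by move=> j i; rewrite expn_gt0.
move=> [x [Ux Uax]].
have Dab : power_pairs (power_sum 0 alpha) (power_sum 1 alpha).
  by exists alpha.
have := seq_of_avoids x 0 Dab; rewrite /U /= in Ux; rewrite Ux !add0n /=.
have := Uax ord0 I; have := Uax ord_max I.
by rewrite /U /= !iter_shift !addn0 -!/(power_sum _ _) => -> ->.
Qed.

End counterexample.

Theorem proposition5p4 (R : realType) :
  exists (X : metricType R) (T : X -> X),
    [/\ dynamical_system T, strongly_mixing T, van_der_Waerden_system T
      & ~ multiple_IP_recurrence T].
Proof.
exists (avoiding_shift R power_pairs), (@shift R power_pairs).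
have lac := lacunary_power_pairs; split.
- split; last exact: shift_continuous.
    by exists (AvoidingSeq R singleton_avoids).
  exact: avoiding_shift_compact.
- exact: shift_strongly_mixing.
- exact: shift_van_der_Waerden.
- exact: shift_not_multiple_IP_recurrence.
Qed.
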